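(* Let $m_0$ and $m$ be natural numbers with $m\ge m_0$, and let $f\in C^{2m-}$. Suppose that $$f^{(2j-1)}(x)\to0\ \text{ as }x\to\infty\quad\text{for } j=m_0,\dots,m-1,$$ and $$\int_0^\infty|f^{(2m-1)}(x)|\,dx<\infty.$$ Let $F$ be any antiderivative of $f$, so that $F'=f$. Then the following limit exists and $$\sum_{k\ge0}^{\mathrm{EM}}f(k):=\lim_{n\to\infty}\Big(\sum_{k=0}^{n-1}f(k)-G^{\mathrm{EM}}_{m_0,F}(n)\Big)=f(0)-G^{\mathrm{EM}}_{m,F}(1)+R^{\mathrm{EM}}_{m,f}(\infty),$$ where $$G^{\mathrm{EM}}_{m,F}(n):=F(n-1)+\frac{F'(n-1)}2+\sum_{j=1}^{m-1}\frac{B_{2j}}{(2j)!}F^{(2j)}(n-1)$$ (and $G^{\mathrm{EM}}_{m_0,F}$ is given by the same formula with $m_0$ in place of $m$), and $$R^{\mathrm{EM}}_{m,f}(\infty):=\frac1{(2m-1)!}\int_0^\infty f^{(2m-1)}(x)\,B_{2m-1}(x-\lfloor x\rfloor)\,dx.$$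
   Context: For a natural number $\alpha$, $C^{\alpha-}$ denotes the set of all functions $f:\mathbb R\to\mathbb R$ having continuous derivatives $f^{(i)}$ of all orders $i=0,\dots,\alpha-1$ and such that $f^{(\alpha-1)}$ is absolutely continuous, with a Radon–Nikodym derivative denoted by $f^{(\alpha)}$. Bernoulli polynomials: $B_0(x)=1$, $B_j'(x)=jB_{j-1}(x)$, $\int_0^1B_j(x)\,dx=0$ for $j\ge1$; Bernoulli numbers: $B_j=B_j(0)$ for $j\ge2$. The sum of an empty family is $0$. *)

(* Defs.v *)
From HB Require Import structures.
From mathcomp Require Export all_boot all_order all_algebra.
From mathcomp Require Export all_classical all_reals all_analysis.

Set Implicit Arguments.
Unset Strict Implicit.
Unset Printing Implicit Defensive.

Export Order.TTheory GRing.Theory Num.Theory.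
Export numFieldNormedType.Exports.

Local Open Scope ring_scope.
Local Open Scope classical_set_scope.

(* The non-overlapping families allow degenerate intervals (u i = v i). *)
Definition abs_continuous_on (R : realType) (a b : R) (g : R -> R) : Prop :=
  forall e : R, 0 < e -> exists2 d : R, 0 < d &
    forall (n : nat) (u v : 'I_n -> R),
      (forall i, [/\ a <= u i, u i <= v i & v i <= b]) ->
      trivIset [set: 'I_n] (fun i => `]u i, v i[) ->
      \sum_(i < n) (v i - u i) < d ->
      \sum_(i < n) `|g (v i) - g (u i)| < e.

(* On the whole line, absolute continuity means absolute continuity on every
   compact interval; equivalently, g is an indefinite integral of a locally
   integrable Radon-Nikodym derivative. *)
Definition abs_continuous (R : realType) (g : R -> R) : Prop :=
  forall a b : R, a <= b -> abs_continuous_on a b g.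

(* C^{alpha-}, for alpha >= 1. Since f^`(i) is total, the existence of
   the derivatives has to be required through [derivable]. *)
Definition Cminus (R : realType) (alpha : nat) (f : R -> R) : Prop :=
  [/\ forall i : nat, (i.+1 < alpha)%N -> forall x : R, derivable f^`(i) x 1,
      forall i : nat, (i < alpha)%N -> continuous f^`(i)
    & abs_continuous f^`(alpha.-1)].

(* The coefficient of index 0 is p`_0 / 0 = 0. *)
Definition poly_antideriv (R : fieldType) (p : {poly R}) : {poly R} :=
  \poly_(i < (size p).+1) (p`_i.-1 / i%:R).

Definition bernoulli_poly_next (R : realType) (j : nat) (p : {poly R}) :
    {poly R} :=
  let q := j.+1%:R *: poly_antideriv p in
  q - (\int[lebesgue_measure]_(x in `[0, 1]) q.[x])%:P.

(* The polynomials determined by bernoulli_poly0, deriv_bernoulli_poly and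
   Rintegral_bernoulli_poly below. *)
Fixpoint bernoulli_poly (R : realType) (j : nat) : {poly R} :=
  if j is i.+1 then bernoulli_poly_next i (bernoulli_poly R i) else 1.

Lemma bernoulli_poly0 (R : realType) : bernoulli_poly R 0 = 1.
Proof. by []. Qed.

Lemma deriv_poly_antideriv (R : numFieldType) (p : {poly R}) :
  deriv (poly_antideriv p) = p.
Proof.
apply/polyP => i; rewrite coef_deriv coef_poly ltnS.
case: ltnP => [_|/leq_sizeP/(_ i (leqnn _)) ->]; last by rewrite mul0rn.
by rewrite -[LHS]mulr_natr divfK ?pnatr_eq0.
Qed.

Lemma deriv_bernoulli_poly (R : realType) (j : nat) : (0 < j)%N ->
  deriv (bernoulli_poly R j) = j%:R *: bernoulli_poly R j.-1.
Proof.
case: j => // j _.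
by rewrite /= derivB derivC subr0 derivZ deriv_poly_antideriv.
Qed.

Lemma Rintegral_bernoulli_poly (R : realType) (j : nat) : (0 < j)%N ->
  \int[lebesgue_measure]_(x in `[0, 1]) (bernoulli_poly R j).[x] = 0.
Proof.
case: j => // j _ /=.
rewrite /bernoulli_poly_next; set q := _ *: _.
set c := \int[lebesgue_measure]_(x in `[0, 1]) q.[x].
have int_poly (p : {poly R}) : lebesgue_measure.-integrable
    (`[0, 1] : set R) (EFin \o (fun x => p.[x])).
  apply: continuous_compact_integrable; first exact: segment_compact.
  apply: continuous_subspaceT => x.
  exact: continuous_horner.
have int01 (a : R) : \int[lebesgue_measure]_(_ in `[0, 1]) a = a.
  rewrite Rintegral_cst// [X in fine X]lebesgue_measure_itv/= lte_fin ltr01.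
  by rewrite -EFinB/= subr0 mulr1.
have -> : \int[lebesgue_measure]_(x in `[0, 1]) (q - c%:P).[x] =
    \int[lebesgue_measure]_(x in `[0, 1]) q.[x] -
    \int[lebesgue_measure]_(_ in `[0, 1]) c.
  rewrite -(RintegralB _ (int_poly q))//; last first.
    have := int_poly c%:P.
    by congr (_.-integrable _ _); apply/funext => x /=; rewrite hornerC.
  by apply: eq_Rintegral => x _ /=; rewrite hornerD hornerN hornerC.
by rewrite int01 subrr.
Qed.

Definition bernoulli_number (R : realType) (j : nat) : R :=
  (bernoulli_poly R j).[0].

Definition EM_G (R : realType) (m : nat) (F : R -> R) (x : R) : R :=
  F (x - 1) + F^`()%classic (x - 1) / 2
  + \sum_(1 <= j < m)
      bernoulli_number R (2 * j) / ((2 * j)`!)%:R * F^`(2 * j)%classic (x - 1).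

Definition EM_remainder (R : realType) (m : nat) (f : R -> R) : R :=
  ((2 * m).-1`!)%:R^-1 *
  \int[lebesgue_measure]_(x in `[0, +oo[)
    (f^`((2 * m).-1)%classic x *
     (bernoulli_poly R (2 * m).-1).[x - (Num.floor x)%:~R]).

Definition EM_seq (R : realType) (m0 : nat) (f F : R -> R) (n : nat) : R :=
  \sum_(0 <= k < n) f k%:R - EM_G m0 F n%:R.

Definition EM_sum (R : realType) (m0 : nat) (f F : R -> R) : R :=
  limn (EM_seq m0 f F).

(* Main.v *)
Require Import Defs.
From mathcomp Require Import measurable_realfun ring lra.

(* Writing B_i for the Bernoulli polynomials, the function
     y |-> \sum_(i <= n) (-1)^i / i! * F^(i)(y) * B_i(y - k)
   has the derivative (-1)^n / n! * F^(n+1)(y) * B_n(y - k), because the sum of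
   the product-rule terms telescopes; this replaces the repeated integrations by
   parts. For n = 2m - 1, the fundamental theorem of calculus on [k, k + 1],
   together with B_i(1) = (-1)^i B_i(0) = B_i(0) + [i = 1], gives the
   Euler-Maclaurin formula on [k, k + 1], whose boundary terms telescope in k.
   The integral over [0, N] converges since f^(2m-1) is integrable and B_n is
   bounded on [0, 1], while G_m0 and G_m differ by a null sequence. *)

Set Implicit Arguments.
Unset Strict Implicit.
Unset Printing Implicit Defensive.

Local Open Scope ring_scope.
Local Open Scope classical_set_scope.

(** * Bernoulli polynomials: endpoint values and reflection *)

Lemma deriv_eq0_polyC (R : numFieldType) (p : {poly R}) :
  deriv p = 0 -> p = (p.[0])%:P.
Proof.
move=> dp; apply/polyP => -[|i]; rewrite coefC/= ?horner_coef0//.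
have := congr1 (fun q : {poly R} => q`_i) dp.
by rewrite /= coef_deriv coef0 => /eqP; rewrite mulrn_eq0/= => /eqP.
Qed.

Lemma Rintegral_deriv (R : realType) (G g : R -> R) (a b : R) : a < b ->
  continuous g -> (forall x : R, is_derive x 1 G (g x)) ->
  \int[lebesgue_measure]_(x in `[a, b]) g x = G b - G a.
Proof.
move=> ab cg dG.
have cG : continuous G.
  move=> x; apply/differentiable_continuous/derivable1_diffP.
  exact: ex_derive.
rewrite /Rintegral (@continuous_FTC2 _ g G)//.
- exact: continuous_subspaceT.
- split; first by move=> x _; exact: ex_derive.
  + exact/cvg_at_right_filter/cG.
  + exact/cvg_at_left_filter/cG.
- by move=> x _; rewrite derive1E derive_val.
Qed.

(** For [j >= 2] the increment over [0, 1] is the integral of [j * B_(j-1)], which vanishes; for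
    [j = 1], [B_1 - 'X] is constant. *)
Lemma bernoulli_poly_at1 (R : realType) (j : nat) :
  (bernoulli_poly R j).[1] = bernoulli_number R j + (j == 1)%:R.
Proof.
rewrite /bernoulli_number; case: j => [|[|j]].
- by rewrite bernoulli_poly0 !hornerE.
- have /deriv_eq0_polyC/(congr1 (fun p => p.[1])) :
      deriv (bernoulli_poly R 1 - 'X) = 0.
    by rewrite derivB derivX deriv_bernoulli_poly// scale1r subrr.
  by rewrite !hornerE subr0 => <-; rewrite subrK.
pose G := j.+2%:R^-1 *: bernoulli_poly R j.+2.
have dG : deriv G = bernoulli_poly R j.+1.
  by rewrite /G derivZ deriv_bernoulli_poly// scalerA mulVf ?scale1r ?pnatr_eq0.
have := @Rintegral_deriv R (horner G) (horner (deriv G)) 0 1 ltr01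
  (@continuous_horner _ _) (fun=> is_derive_poly _ _).
rewrite dG Rintegral_bernoulli_poly// => /esym/eqP.
rewrite /G !hornerZ -mulrBr mulf_eq0 invr_eq0 pnatr_eq0/= subr_eq0 => /eqP ->.
by rewrite addr0.
Qed.

(** Reflection formula. The defect [q j] of the identity satisfies a recursion like that of the
    Bernoulli polynomials, up to sign, so [q j = 0] makes [q j.+1] constant; equal values of
    [q j.+2] at 0 and 1 force this constant to be 0. *)
Lemma comp_bernoulli_poly (R : realType) (j : nat) :
  bernoulli_poly R j \Po (1 - 'X) = (- 1) ^+ j *: bernoulli_poly R j.
Proof.
pose q j := bernoulli_poly R j \Po (1 - 'X) - (- 1) ^+ j *: bernoulli_poly R j.
have dq i : deriv (q i.+1) = - i.+1%:R *: q i.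
  rewrite /q derivB deriv_comp derivZ deriv_bernoulli_poly// derivB.
  rewrite -polyC1 derivC derivX sub0r comp_polyZ mulrN1 scalerBr !scalerA.
  by rewrite scaleNr exprS; congr (_ - _ *: _); ring.
have q10 i : (q i.+2).[1] = (q i.+2).[0].
  have := bernoulli_poly_at1 R i.+2; rewrite /bernoulli_number addr0 /q.
  move: (bernoulli_poly R i.+2) => b b1.
  by rewrite !hornerE !horner_comp !hornerE subrr subr0 b1.
have q0 : q 0 = 0 by rewrite /q bernoulli_poly0 expr0 scale1r comp_polyC subrr.
apply/eqP; rewrite -subr_eq0 -/(q j); apply/eqP.
clearbody q; elim: j => [//|j IH].
(* [q j.+1] is a constant [c], and [q j.+2], with derivative [- j.+2 * c],
   takes the same value at 0 and 1. *)
have qc : q j.+1 = (q j.+1).[0]%:P.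
  by apply: deriv_eq0_polyC; rewrite dq IH scaler0.
set c := (q j.+1).[0] in qc.
have /deriv_eq0_polyC/(congr1 (fun p => p.[1])) :
    deriv (q j.+2 + (j.+2%:R * c) *: 'X) = 0.
  rewrite derivD dq derivZ derivX qc -!mul_polyC mulr1 -polyCM -polyCD.
  by rewrite mulNr addNr.
rewrite hornerC !hornerD !hornerZ !hornerX mulr0 addr0 mulr1 q10.
move/eqP; rewrite addrC -subr_eq0 addrK mulf_eq0 pnatr_eq0/= => /eqP c0.
by rewrite qc c0.
Qed.

Lemma bernoulli_poly_at1_sign (R : realType) (j : nat) :
  (bernoulli_poly R j).[1] = (- 1) ^+ j * bernoulli_number R j.
Proof.
have := congr1 (horner^~ 1) (comp_bernoulli_poly R j).
rewrite horner_comp !hornerE subrr /bernoulli_number => ->.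
by rewrite mulrA -expr2 sqrr_sign mul1r.
Qed.

(** The two expressions for [B_1(1)] give [- B_1 = B_1 + 1]. *)
Lemma bernoulli_number1 (R : realType) : bernoulli_number R 1 = - 2^-1.
Proof.
have := bernoulli_poly_at1 R 1; rewrite bernoulli_poly_at1_sign/= expr1.
by move=> b1; lra.
Qed.

(** For an odd index above 1, the two expressions for the value at 1 give [- B = B]. *)
Lemma bernoulli_number_odd (R : realType) (j : nat) : (0 < j)%N ->
  bernoulli_number R (2 * j).+1 = 0.
Proof.
case: j => // j _; have := bernoulli_poly_at1 R (2 * j.+1).+1.
rewrite bernoulli_poly_at1_sign -signr_odd oddS oddM expr1 addr0.
by move=> b; lra.
Qed.

(** * Euler-Maclaurin formula on one unit interval *)

Lemma is_derive_bernoulli_sum (R : realType) (F : R -> R) (n : nat) (k x : R) :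
  (forall i : nat, (i <= n)%N -> derivable F^`(i)%classic x 1) ->
  is_derive x 1
    (fun y => \sum_(0 <= i < n.+1) (- 1) ^+ i / i`!%:R *
       (F^`(i)%classic y * (bernoulli_poly R i).[y - k]))
    ((- 1) ^+ n / n`!%:R *
       (F^`(n.+1)%classic x * (bernoulli_poly R n).[x - k])).
Proof.
move=> dF.
have dterm i : (i <= n)%N -> is_derive x 1
    (fun y => (- 1) ^+ i / i`!%:R *
       (F^`(i)%classic y * (bernoulli_poly R i).[y - k]))
    ((- 1) ^+ i / i`!%:R * (F^`(i.+1)%classic x * (bernoulli_poly R i).[x - k] +
       i%:R * (F^`(i)%classic x * (bernoulli_poly R i.-1).[x - k]))).
  move=> /dF dFi; have dFi' : is_derive x 1 F^`(i)%classic (F^`(i.+1)%classic x).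
    by rewrite derive1nS derive1E; exact/derivableP.
  have -> : (fun y => (- 1) ^+ i / i`!%:R *
        (F^`(i)%classic y * (bernoulli_poly R i).[y - k])) =
      ((- 1) ^+ i / i`!%:R) \*:
        (F^`(i)%classic * horner (bernoulli_poly R i \Po ('X - k%:P))).
    by apply/funext => y /=; rewrite mulrfctE horner_comp hornerXsubC.
  apply: is_derive_eq.
  rewrite deriv_comp derivB derivX derivC subr0 mulr1 horner_comp hornerXsubC.
  (* The truncated predecessor at [i = 0] is harmless, since the factor [i%:R] is then 0. *)
  have -> : (bernoulli_poly R i)^`()%R = i%:R *: bernoulli_poly R i.-1.
    case: i {dFi dFi'} => [|i]; last exact: deriv_bernoulli_poly.
    by rewrite bernoulli_poly0 -polyC1 derivC scale0r.
  rewrite hornerZ horner_comp hornerXsubC /GRing.scale/=.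
  ring.
elim: n {dF} dterm => [|n IH] dterm.
  under eq_fun do rewrite big_nat1.
  by apply: (is_derive_eq (dterm 0 _)) => //; rewrite mul0r addr0.
under eq_fun do rewrite big_nat_recr//=.
apply: (is_derive_eq (is_deriveD (IH _) (dterm _ _))) => //.
  by move=> i le_in; apply: dterm; rewrite (leq_trans le_in).
(* The part of the new term that contains [B_n] cancels the derivative of the previous partial sum:
   (n+1)/(n+1)! = 1/n!, with opposite signs. *)
rewrite factS natrM invfM exprS /=.
have : n`!%:R != 0 :> R by rewrite pnatr_eq0 -lt0n fact_gt0.
have : n.+1%:R != 0 :> R by rewrite pnatr_eq0.
move: (n.+1%:R) (n`!%:R) => a b a0 b0.
by field; rewrite a0 b0.
Qed.

Lemma euler_maclaurin_step (R : realType) (F : R -> R) (n : nat) (k : R) :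
  (0 < n)%N ->
  (forall i : nat, (i <= n)%N -> forall x : R, derivable F^`(i)%classic x 1) ->
  continuous F^`(n.+1)%classic ->
  \int[lebesgue_measure]_(x in `[k, k + 1])
     ((- 1) ^+ n / n`!%:R *
        (F^`(n.+1)%classic x * (bernoulli_poly R n).[x - k])) =
  \sum_(0 <= i < n.+1) bernoulli_number R i / i`!%:R *
     (F^`(i)%classic (k + 1) - F^`(i)%classic k) - F^`()%classic k.
Proof.
move=> n0 dF cF.
have dP x := @is_derive_bernoulli_sum R F n k x (fun i lin => dF i lin x).
rewrite (Rintegral_deriv _ _ dP); first last.
- have -> : (fun x => (- 1) ^+ n / n`!%:R *
       (F^`(n.+1)%classic x * (bernoulli_poly R n).[x - k])) =
      cst ((- 1) ^+ n / n`!%:R) *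
        (F^`(n.+1)%classic * horner (bernoulli_poly R n \Po ('X - k%:P))).
    by apply/funext => y; rewrite !mulrfctE horner_comp hornerXsubC.
  move=> x; apply: cvgM; first exact: cvg_cst.
  by apply: cvgM; [exact: cF|exact: continuous_horner].
- by rewrite ltrDl.
rewrite -sumrB addrAC subrr add0r.
(* The isolated derivative is spread over the sum, index 1 being in range as [0 < n]; it then
   absorbs the correction [(i == 1)%:R] termwise. *)
have -> : F^`()%classic k = \sum_(0 <= i < n.+1) (i == 1)%:R * F^`(i)%classic k.
  case: n n0 {dF cF dP} => // n _.
  rewrite big_nat_recl// big_nat_recl//= mul0r add0r mul1r.
  by rewrite big1 ?addr0// => i _; rewrite mul0r.
rewrite -sumrB; apply: eq_bigr => i _.
have sgn1 : (- 1) ^+ i * (bernoulli_poly R i).[1] = bernoulli_number R i.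
  by rewrite bernoulli_poly_at1_sign mulrA -expr2 sqrr_sign mul1r.
have sgn0 : (- 1) ^+ i * bernoulli_number R i =
    bernoulli_number R i + (i == 1)%:R.
  by rewrite -bernoulli_poly_at1_sign bernoulli_poly_at1.
rewrite -/(bernoulli_number R i).
transitivity
  (((- 1) ^+ i * (bernoulli_poly R i).[1]) / i`!%:R * F^`(i)%classic (k + 1) -
   ((- 1) ^+ i * bernoulli_number R i) / i`!%:R * F^`(i)%classic k); first by ring.
rewrite sgn1 sgn0 mulrDl mulrDl mulrBr opprD addrA; congr (_ - _ * _).
by case: eqP => [->|_]; rewrite ?mul0r// divr1.
Qed.

(** * Convergence of integrals and functions of the fractional part *)

Lemma cvg_integral_nondecreasing_set d (T : measurableType d) (R : realType)
    (mu : measure T R) (A : (set T)^nat) (g : T -> \bar R) :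
  {homo A : n m / (n <= m)%N >-> (n <= m)%O} ->
  (forall n, measurable (A n)) ->
  mu.-integrable (\bigcup_n A n) g ->
  (\int[mu]_(x in A n) g x @[n --> \oo] --> \int[mu]_(x in \bigcup_n A n) g x)%E.
Proof.
move=> homoA mA intg.
have mUA : measurable (\bigcup_n A n) by exact: bigcup_measurable.
have mg n : measurable_fun (A n) g.
  apply: measurable_funS (measurable_int mu intg) => //.
  exact: bigcup_sup.
(* Monotone convergence applies to the positive and negative parts separately; integrability
   excludes the form oo - oo. *)
under eq_fun do rewrite integralE.
rewrite integralE; apply: cvgeB.
- apply: fin_num_adde_defl.
  by rewrite fin_numN; exact: integrable_neg_fin_num.
- apply: ge0_nondecreasing_set_cvg_integral => // n; exact: measurable_funepos.
- apply: ge0_nondecreasing_set_cvg_integral => // n; exact: measurable_funeneg.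
Qed.

Lemma bounded_horner_fractional (R : realType) (p : {poly R}) :
  exists M : R, forall x : R, `|p.[x - (Num.floor x)%:~R]| <= M.
Proof.
have [M pM] := poly_itv_bound p 0 1.
exists M => x; apply: pM; have /andP[] := floor_itv x.
by rewrite intrD => ? ?; apply/andP; split; lra.
Qed.

(** On each [[k, k + 1[] the floor is constant, so the function is a polynomial there, and countably
    many such pieces cover the half-line. *)
Lemma measurable_horner_fractional (R : realType) (p : {poly R}) :
  measurable_fun (`[0, +oo[ : set R) (fun x : R => p.[x - (Num.floor x)%:~R]).
Proof.
rewrite (_ : `[0, +oo[ = \bigcup_k `[k%:R, k%:R + 1[ :> set R); last first.
  apply/seteqP; split=> x /=; rewrite in_itv/=.
    rewrite andbT => x0; have := floor_itv x.
    have : 0 <= Num.floor x by rewrite floor_ge0.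
    case: (Num.floor x) => // k _; rewrite intrD => xk.
    by exists k => //=; rewrite in_itv.
  move=> [k _ /=]; rewrite in_itv/= andbT => /andP[+ _].
  exact: le_trans.
apply/measurable_fun_bigcup => // k.
apply: (eq_measurable_fun (horner (p \Po ('X - k%:R%:P)))).
  move=> x; rewrite inE/= in_itv/= => xk.
  by rewrite horner_comp hornerXsubC (@floor_def _ _ k%:Z)// intrD.
exact: measurable_poly.
Qed.

(** * The boundary terms [EM_G] as full Bernoulli sums *)

Lemma sum_nat_odd_eq0 (V : nmodType) (u : nat -> V) (m : nat) : (0 < m)%N ->
  (forall j, (0 < j)%N -> u (2 * j).+1 = 0) ->
  \sum_(0 <= i < 2 * m) u i = u 0 + u 1 + \sum_(1 <= j < m) u (2 * j)%N.
Proof.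
case: m => // m _ u0; elim: m => [|m IH].
  by rewrite [in RHS]big_geq// addr0 unlock /= addr0.
have -> : (2 * m.+2 = (2 * m.+1).+2)%N by rewrite mulnS.
rewrite big_nat_recr// big_nat_recr// IH.
by rewrite [in RHS]big_nat_recr//= u0// addr0 addrA.
Qed.

(** This matches [EM_G] with the sums of [euler_maclaurin_step]. As [B_1 = -1/2], the term F'(x)/2
    is F'(x) plus the index-1 term of the sum; the higher odd terms vanish. *)
Lemma EM_GE (R : realType) (m : nat) (F : R -> R) (x : R) : (0 < m)%N ->
  EM_G m F (x + 1) = F^`()%classic x +
    \sum_(0 <= i < 2 * m) bernoulli_number R i / i`!%:R * F^`(i)%classic x.
Proof.
move=> m0; rewrite sum_nat_odd_eq0//; last first.
  by move=> j j0; rewrite bernoulli_number_odd// !mul0r.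
rewrite /EM_G addrK bernoulli_number1 /bernoulli_number bernoulli_poly0.
rewrite hornerC fact0 addrA; congr (_ + _).
rewrite derive1n0 derive1n1 (_ : 1`! = 1)%N// divr1 mul1r.
by field.
Qed.

Lemma EM_G_split (R : realType) (m0 m : nat) (F : R -> R) (x : R) :
  (0 < m0)%N -> (m0 <= m)%N ->
  EM_G m F x = EM_G m0 F x + \sum_(m0 <= j < m)
    bernoulli_number R (2 * j) / ((2 * j)`!)%:R * F^`(2 * j)%classic (x - 1).
Proof. by move=> m0_gt0 m0m; rewrite /EM_G (big_cat_nat m0_gt0 m0m)/= addrA. Qed.

(** * The remainder integral over unit intervals *)

Lemma Rintegral_nat_itv (R : realType) (g : R -> R) (N : nat) :
  (@lebesgue_measure R).-integrable `[0, +oo[ (EFin \o g) ->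
  \int[lebesgue_measure]_(x in `[0, N%:R[) g x =
  \sum_(0 <= k < N) \int[lebesgue_measure]_(x in `[k%:R, k%:R + 1[) g x.
Proof.
move=> intg; elim: N => [|N IH].
  by rewrite big_geq// set_itvco0 Rintegral_set0.
rewrite big_nat_recr//= -IH -natr1.
have N0 : 0 <= N%:R :> R by [].
rewrite (@itv_bndbnd_setU _ _ _ (BLeft N%:R)) ?bnd_simp ?lerDl//.
rewrite Rintegral_setU//=.
- rewrite -itv_bndbnd_setU ?bnd_simp ?lerDl//.
  by apply: integrableS intg => //; exact: subset_itvl.
- apply/disj_setPS => y [/=]; rewrite !in_itv/= => /andP[_ yx] /andP[].
  by rewrite leNgt yx.
Qed.

Lemma integrable_mul_horner_fractional (R : realType) (g : R -> R)
    (p : {poly R}) : continuous g ->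
  (\int[lebesgue_measure]_(x in `[0%R, +oo[) `|g x|%:E < +oo)%E ->
  (@lebesgue_measure R).-integrable `[0, +oo[
    (EFin \o (fun x => g x * p.[x - (Num.floor x)%:~R])).
Proof.
move=> cg g_int.
have mg : (@lebesgue_measure R).-integrable `[0, +oo[ (EFin \o g).
  apply/integrableP; split => //.
  by apply/measurable_EFinP/measurable_funTS; exact: continuous_measurable_fun.
have [M bM] := bounded_horner_fractional p.
apply: integrableMl mg (measurable_horner_fractional _) _ => //.
exists M; split; first exact: num_real.
by move=> y My x _ /=; rewrite (le_trans (bM x)) ?ltW.
Qed.

Lemma Rintegral_EM_step (R : realType) (n : nat) (F : R -> R) (k : nat) :
  odd n ->
  (forall i : nat, (i <= n)%N -> forall x : R, derivable F^`(i) x 1) ->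
  continuous F^`(n.+1) ->
  n`!%:R^-1 * \int[lebesgue_measure]_(x in `[k%:R, k%:R + 1[)
     (F^`(n.+1)%classic x * (bernoulli_poly R n).[x - (Num.floor x)%:~R]) =
  F^`()%classic k%:R - \sum_(0 <= i < n.+1) bernoulli_number R i / i`!%:R *
     (F^`(i)%classic (k.+1)%:R - F^`(i)%classic k%:R).
Proof.
move=> n_odd dF cF.
pose h x := F^`(n.+1)%classic x * (bernoulli_poly R n).[x - k%:R].
have inth : (@lebesgue_measure R).-integrable `[k%:R, k%:R + 1]
    (EFin \o h).
  apply: continuous_compact_integrable; first exact: segment_compact.
  apply: continuous_subspaceT.
  rewrite (_ : h = F^`(n.+1)%classic *
      horner (bernoulli_poly R n \Po ('X - k%:R%:P))).
    by move=> x; apply: cvgM; [exact: cF|exact: continuous_horner].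
  by apply/funext => y; rewrite mulrfctE horner_comp hornerXsubC.
under eq_Rintegral => x.
  rewrite inE/= in_itv/= => xk.
  rewrite (@floor_def _ _ k%:Z)// ?intrD// -/(h x).
  over.
(* The floor jumps at [k + 1], but [h] does not; once the integrand is [h], this null endpoint can
   be added. *)
rewrite Rintegral_itv_bndo_bndc; last first.
  by apply: integrableS inth => //; apply: subset_itvl; rewrite bnd_simp.
(* Both sides are negated because [(- 1) ^+ n = - 1] for odd [n]. *)
rewrite -RintegralZl// -natr1 -[LHS]opprK -[RHS]opprK opprB; congr (- _).
rewrite -euler_maclaurin_step//; last by case: n n_odd {dF cF h inth}.
rewrite -signr_odd n_odd expr1 -[LHS]mulN1r -RintegralZl//.
  by apply: eq_Rintegral => x _; rewrite !mulrA.
have := integrableZl _ n`!%:R^-1 inth.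
by apply.
Qed.

(** * Passage to the limit *)

Theorem proposition5p3 (R : realType) (m0 m : nat) (f F : R -> R)
  (m0_gt0 : (0 < m0)%N) (le_m0m : (m0 <= m)%N)
  (f_C : Cminus (2 * m) f)
  (f_cvg0 : forall j : nat, (m0 <= j < m)%N ->
    f^`((2 * j).-1) x @[x --> +oo] --> (0 : R))
  (f_int : (\int[lebesgue_measure]_(x in `[0%R, +oo[)
              `|f^`((2 * m).-1)%classic x|%:E < +oo)%E)
  (F_antideriv : forall x : R, is_derive x 1 F (f x)) :
  cvgn (EM_seq m0 f F) /\
  EM_sum m0 f F = f 0 - EM_G m F 1 + EM_remainder m f.
Proof.
have m_gt0 : (0 < m)%N by exact: leq_trans le_m0m.
case: f_C => f_derivable f_continuous _.
have dF : F^`() = f by apply/funext => x; rewrite derive1E derive_val.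
have dFn i : F^`(i.+1) = f^`(i) by rewrite derive1Sn dF.
set n := (2 * m).-1 in f_int *.
have nS : n.+1 = (2 * m)%N by rewrite prednK// muln_gt0.
have n_odd : odd n.
  by have := congr1 odd nS; rewrite /= mul2n odd_double => /negbFE.
have F_derivable i : (i <= n)%N -> forall x : R, derivable F^`(i) x 1.
  case: i => [_ x|i lt_in x]; first exact: ex_derive.
  by rewrite dFn; apply: f_derivable; rewrite -nS ltnS.
have cfn : continuous f^`(n) by apply: f_continuous; rewrite -nS.
pose g x := f^`(n)%classic x * (bernoulli_poly R n).[x - (Num.floor x)%:~R].
have intg := integrable_mul_horner_fractional (bernoulli_poly R n) cfn f_int.
(* [D N] is the difference of [EM_G m F] and [EM_G m0 F] at [N + 1]; its derivatives of [F] are the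
   odd-order derivatives of [f] assumed to tend to 0. *)
pose D (N : nat) := \sum_(m0 <= j < m)
  bernoulli_number R (2 * j) / ((2 * j)`!)%:R * F^`(2 * j)%classic N%:R.
have D0 : D N @[N --> \oo] --> (0 : R).
  (* The range is repeated as a condition so that [m0 <= j < m] is available for each term's
     limit. *)
  rewrite (_ : 0 = \sum_(m0 <= j < m | (m0 <= j < m)%N && true) 0); last first.
    by rewrite big1.
  under eq_fun do rewrite /D big_nat_cond.
  apply: cvg_big => [|j /andP[mjm _]]; first exact: add_continuous.
  rewrite -[X in _ --> X](mulr0 (bernoulli_number R (2 * j) / ((2 * j)`!)%:R)).
  apply: cvgM; first exact: cvg_cst.
  have -> : (2 * j)%N = (2 * j).-1.+1.
    by case/andP: mjm => /(leq_trans m0_gt0) j_gt0 _; rewrite prednK// muln_gt0.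
  rewrite dFn; exact: (cvg_comp _ _ cvgr_idn (f_cvg0 j mjm)).
pose J (N : nat) := \int[lebesgue_measure]_(x in `[0, N%:R[) g x.
have Jcvg : J N @[N --> \oo] --> \int[lebesgue_measure]_(x in `[0, +oo[) g x.
  apply: fine_cvg; rewrite fineK; last exact: integrable_fin_num.
  rewrite itvbndyEbigcup in intg *.
  apply: cvg_integral_nondecreasing_set => // i j ij.
  apply/subsetPset; apply: subset_itvl.
  by rewrite bnd_simp ler_nat.
(* The index is [N.+1] because [EM_G] evaluates at its argument minus 1. *)
have EM_seqE N : EM_seq m0 f F N.+1 =
    f 0 - EM_G m F 1 + n`!%:R^-1 * J N + D N.
  have -> : n`!%:R^-1 * J N = \sum_(0 <= k < N) f k%:R -
      (\sum_(0 <= i < n.+1) bernoulli_number R i / i`!%:R * F^`(i)%classic N%:R -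
       \sum_(0 <= i < n.+1) bernoulli_number R i / i`!%:R * F^`(i)%classic 0).
    rewrite /J Rintegral_nat_itv// mulr_sumr.
    under eq_bigr => k _.
      rewrite /g -dFn Rintegral_EM_step//; last by rewrite dFn.
      over.
    rewrite sumrB dF exchange_big/=; congr (_ - _).
    rewrite -sumrB; apply: eq_bigr => i _.
    by rewrite -mulr_sumr -mulrBr (telescope_sumr (fun k => F^`(i)%classic k%:R)).
  rewrite /EM_seq -natr1.
  have -> : EM_G m0 F (N%:R + 1) = EM_G m F (N%:R + 1) - D N.
    have := EM_G_split F (N%:R + 1) m0_gt0 le_m0m; rewrite addrK -/(D N) => ->.
    by rewrite [RHS]addrK.
  have -> : EM_G m F 1 = EM_G m F (0 + 1) by rewrite add0r.
  (* The last summand [f N%:R] cancels the F'(N) from [EM_GE], and [f 0] cancels the F'(0) from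
     [EM_G m F 1]. *)
  rewrite !EM_GE// dF nS big_nat_recr//=.
  ring.
have EM_cvg : EM_seq m0 f F N @[N --> \oo] -->
    f 0 - EM_G m F 1 + EM_remainder m f.
  rewrite -cvg_shiftS; under eq_fun do rewrite EM_seqE.
  rewrite -[EM_remainder _ _]addr0 addrA.
  by apply: cvgD D0; apply: cvgD; [exact: cvg_cst|apply: cvgM Jcvg; exact: cvg_cst].
split; first by apply/cvg_ex; eexists; exact: EM_cvg.
exact: cvg_lim EM_cvg.
Qed.
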